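(* If $f:[-\frac14,\frac14]\to[0,\infty)$ is a nonnegative (integrable) function with $\int f(x)\,dx=1$, then $\|f\ast f\|_\infty\ge 1.2748$.
   Context: The function $f$ is regarded as a function on $\mathbb{R}$ that vanishes outside $[-\frac14,\frac14]$. Its autoconvolution is $f\ast f(x)=\int_{\mathbb{R}} f(t)f(x-t)\,dt$, and $\|f\ast f\|_\infty$ denotes its (essential) supremum, which may be $+\infty$. *)

(* Defs.v *)
From mathcomp Require Import all_boot all_order all_algebra.
From mathcomp Require Import all_classical all_reals all_analysis.
Set Implicit Arguments.
Unset Strict Implicit.
Unset Printing Implicit Defensive.
Local Open Scope ring_scope.

(* The measure is the completed one, so that integrability is integrability of
   Lebesgue-measurable (not only Borel-measurable) functions.  The value lives
   in \bar R because the integral may diverge at some points x. *)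
Definition autoconv (R : realType) (f : R -> R) (x : R) : \bar R :=
  (\int[@completed_lebesgue_measure R]_t (f t * f (x - (t : R)))%:E)%E.

(* Main.v *)
(* Idea. Let g = f * f and let rho(z) = int f(t) f(z + t) dt be the
   autocorrelation of f; suppose g <= M almost everywhere, with M = 3187/2500.
   Let K(x) = 7 max(0, 1 - 20|x|) + 5 max(0, 1 - 4|x|).

   Upper bound: int g K <= M int K.  Tonelli gives int rho^2 = int g^2 <= M, and
   integrating (5 rho - K - 17/5)^2 >= 0 over [-1/2, 1/2] bounds int rho K.

   Lower bound: int g K + int rho K = int int f(x) f(y) (K(x + y) + K(x - y)).
   A triangle of half-width w is the autocorrelation of an interval of length w,
   so this double integral is half the average over t of 7 sum_j v_j^2 +
   sum_j (v_j + ... + v_{j+4})^2, where v_j is the mass which f(x) + f(-x) gives to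
   the j-th cell of the grid t + Z/20.  At most 11 consecutive cells are charged,
   the total mass is 2, and this finite quadratic form is at least 249/25.

   The two bounds are incompatible: 4.98 <= 4.97735. *)
Require Import Defs.
From mathcomp Require Import all_boot all_order all_algebra.
From mathcomp Require Import all_classical all_reals all_analysis.
From mathcomp Require Import ess_sup_inf.
From mathcomp Require Import measurable_realfun ring lra.
Set Implicit Arguments.
Unset Strict Implicit.
Unset Printing Implicit Defensive.
Import Order.TTheory GRing.Theory Num.Theory.
Import numFieldNormedType.Exports.
Local Open Scope classical_set_scope.
Local Open Scope ring_scope.

(** * Invariance of Lebesgue measure under translations and reflections *)

Section translation_reflection.
Context {R : realType}.
Notation mu := (@lebesgue_measure R).

(** By uniqueness of Lebesgue measure, it suffices that the pushforward gives the half-open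
    intervals their length. *)
Lemma lebesgue_measure_shift (a : R) (A : set R) : measurable A ->
  pushforward mu (fun x : R => x + a : measurableTypeR R) A = mu A.
Proof.
move=> mA; pose h : measurableTypeR R -> measurableTypeR R := fun x => x + a.
have mh : measurable_fun [set: R] h by exact: measurable_funD.
have /(_ mh) E := @lebesgue_measure_unique R (pushforward mu h).
apply/esym; apply: (E _ A mA) => _ [[u v]] _ <-.
rewrite -[RHS]/(mu (h @^-1` `]u, v]%classic)).
rewrite (_ : h @^-1` _ = `]u - a, v - a]%classic); last first.
  by apply/seteqP; split=> x /=; rewrite !in_itv/= ltrBlDr lerBrDr.
rewrite !lebesgue_measure_itv/= !lte_fin ltrD2r; case: ifP => // _.
by rewrite !EFinB -!EFinB; congr EFin; ring.
Qed.

Lemma ge0_integral_shift (a : R) (F : R -> \bar R) :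
    measurable_fun setT F -> (forall x, 0 <= F x)%E ->
  (\int[mu]_x F ((x : R) + a)%R = \int[mu]_x F x)%E.
Proof.
move=> mF F0; pose h : measurableTypeR R -> measurableTypeR R := fun x => x + a.
have mh : measurable_fun [set: R] h by exact: measurable_funD.
have P := @ge0_integral_pushforward _ _ _ _ R h mh mu setT F measurableT mF
  (fun y _ => F0 y).
apply: etrans (esym P) _; unshelve refine (eq_measure_integral _ _) => //.
by move=> A mA _; exact: lebesgue_measure_shift.
Qed.

Lemma lebesgue_measure_reflect (a : R) (A : set R) : measurable A ->
  mu ((fun x : R => a - x) @^-1` A) = mu A.
Proof.
move=> mA.
rewrite (_ : _ @^-1` A = -%R @^-1` ((fun x : R => x + a) @^-1` A)); last first.
  by apply/funext => x; rewrite /preimage/= addrC.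
have mh : measurable_fun [set: R] (fun x : R => x + a) by exact: measurable_funD.
rewrite -[LHS]/(pushforward mu (-%R : _ -> measurableTypeR R) _) lebesgue_measureN.
  exact: lebesgue_measure_shift.
by rewrite -[X in measurable X]setTI; exact: mh.
Qed.

End translation_reflection.

(** * Tonelli's theorem for double and triple iterated integrals *)

Section tonelli.
Context {R : realType}.
Notation mu := (@lebesgue_measure R).
Local Open Scope ereal_scope.

Lemma tonelli2 (A : R -> R -> \bar R) :
    measurable_fun setT (fun p : R * R => A p.1 p.2) ->
    (forall x y, 0 <= A x y) ->
  \int[mu]_x \int[mu]_y A x y = \int[mu]_y \int[mu]_x A x y.
Proof.
move=> mA A0; exact: (@fubini_tonelli _ _ _ _ R mu mu (fun p => A p.1 p.2)).
Qed.

Lemma measurable_integral_snd d (T : measurableType d) (A : T -> R -> \bar R) :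
    measurable_fun setT (fun p : T * R => A p.1 p.2) ->
    (forall x y, 0 <= A x y) ->
  measurable_fun setT (fun x => \int[mu]_y A x y).
Proof.
move=> mA A0.
exact: (@measurable_fun_fubini_tonelli_F _ _ _ _ R mu (fun p => A p.1 p.2)).
Qed.

Lemma tonelli3_rot (A : R -> R -> R -> \bar R) :
    measurable_fun setT (fun p : R * R * R => A p.1.1 p.1.2 p.2) ->
    (forall x y z, 0 <= A x y z) ->
  \int[mu]_x \int[mu]_y \int[mu]_z A x y z =
  \int[mu]_y \int[mu]_z \int[mu]_x A x y z.
Proof.
move=> mA A0; rewrite (tonelli2 (A := fun x y => \int[mu]_z A x y z)).
- apply: eq_integral => y _; apply: tonelli2 => //.
  have mh : measurable_fun setT (fun p : R * R => ((p.1, y), p.2)).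
    by apply: measurable_fun_pair => //; exact: measurable_fun_pair.
  exact: (measurableT_comp mA mh).
- exact: (@measurable_integral_snd _ _ (fun p z => A p.1 p.2 z)).
- by move=> x y; exact: integral_ge0.
Qed.

(** The rotation above, followed by an exchange of y and z. This order is the one that
    [integral_corr_sqr] needs. *)
Lemma tonelli3_rev (A : R -> R -> R -> \bar R) :
    measurable_fun setT (fun p : R * R * R => A p.1.1 p.1.2 p.2) ->
    (forall x y z, 0 <= A x y z) ->
  \int[mu]_x \int[mu]_y \int[mu]_z A x y z =
  \int[mu]_z \int[mu]_y \int[mu]_x A x y z.
Proof.
move=> mA A0; apply: etrans (tonelli3_rot mA A0) _.
apply: (tonelli2 (A := fun y z => \int[mu]_x A x y z)).
- apply: (@measurable_integral_snd _ _ (fun p x => A x p.1 p.2)) => //.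
  have mh : measurable_fun setT (fun p : R * R * R => ((p.2, p.1.1), p.1.2)).
    apply: measurable_fun_pair.
      apply: measurable_fun_pair => //.
      exact: (measurableT_comp measurable_fst measurable_fst).
    exact: (measurableT_comp measurable_snd measurable_fst).
  exact: (measurableT_comp mA mh).
- by move=> x y; exact: integral_ge0.
Qed.

End tonelli.

(** * Autoconvolution, autocorrelation and their equal square integrals *)

Section correlation.
Context {R : realType}.
Notation mu := (@lebesgue_measure R).
Local Open Scope ereal_scope.
Variable f : R -> R.
Hypotheses (mf : measurable_fun setT f) (f0 : forall x, (0 <= f x)%R).

(* [conv_along -%R] is the autoconvolution of f, [conv_along id] its
   autocorrelation. *)
Definition conv_along (s : R -> R) (z : R) : \bar R :=
  \int[mu]_t (f t * f (z + s t)%R)%:E.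

Lemma conv_along_ge0 s z : 0 <= conv_along s z.
Proof. by apply: integral_ge0 => t _; rewrite lee_fin mulr_ge0. Qed.

Lemma measurable_conv_along_integrand (s : R -> R) : measurable_fun setT s ->
  measurable_fun setT (fun p : R * R => (f p.2 * f (p.1 + s p.2)%R)%:E).
Proof.
move=> ms; apply/measurable_EFinP/measurable_funM; first exact: measurableT_comp.
apply: measurableT_comp => //; apply: measurable_funD => //.
exact: measurableT_comp.
Qed.

Lemma measurable_conv_along (s : R -> R) : measurable_fun setT s ->
  measurable_fun setT (conv_along s).
Proof.
move=> ms; apply: (@measurable_integral_snd R _ R
  (fun z t : R => (f t * f (z + s t)%R)%:E)).
- exact: measurable_conv_along_integrand.
- by move=> x y; rewrite lee_fin mulr_ge0.
Qed.

(** Tonelli, then the substitution y = z + s(t) in the inner integral. Weighted integrals of the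
    convolution or correlation thus become double integrals against f(t) f(y). *)
Lemma integral_conv_along (s : R -> R) (phi : R -> \bar R) :
    measurable_fun setT s -> measurable_fun setT phi -> (forall x, 0 <= phi x) ->
  \int[mu]_z (conv_along s z * phi z) =
  \int[mu]_t \int[mu]_y ((f t * f y)%:E * phi ((y : R) - s t)%R).
Proof.
move=> ms mphi phi0.
transitivity (\int[mu]_z \int[mu]_t ((f t * f ((z : R) + s t)%R)%:E * phi z)).
  apply: eq_integral => z _; rewrite -ge0_integralZr//.
  - apply: (measurableT_comp (measurable_conv_along_integrand ms)
      (measurable_pair1 z)).
  - by move=> t _; rewrite lee_fin mulr_ge0.
rewrite tonelli2.
- apply: eq_integral => t _.
  rewrite -[RHS](ge0_integral_shift (s t)).
  + by apply: eq_integral => z _; rewrite addrK.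
  + apply: emeasurable_funM.
      by apply/measurable_EFinP/measurable_funM.
    by apply: measurableT_comp => //; exact: measurable_funB.
  + by move=> x; rewrite mule_ge0// lee_fin mulr_ge0.
- apply: emeasurable_funM; first exact: measurable_conv_along_integrand.
  exact: measurableT_comp.
- by move=> x y; rewrite mule_ge0// lee_fin mulr_ge0.
Qed.

(* Exchanging the outermost and innermost of three integrals turns one side into
   the other, since f(x) f(z) f(y - x + z) f(y) is the integrand of both. *)
Lemma integral_corr_sqr :
  \int[mu]_z (conv_along id z * conv_along id z) =
  \int[mu]_z (conv_along -%R z * conv_along -%R z).
Proof.
have mN : measurable_fun [set: R] (-%R : R -> R) by exact: oppr_measurable.
have mI : measurable_fun [set: R] (id : R -> R) by [].
apply: etrans (integral_conv_along mI (measurable_conv_along mI) (conv_along_ge0 id)) _.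
apply: etrans _ (esym (integral_conv_along mN (measurable_conv_along mN)
  (conv_along_ge0 _))).
pose A (x y z : R) := (f x * f y)%:E * (f z * f (y - x + z)%R)%:E.
have mf' d (T : measurableType d) (h : T -> R) : measurable_fun setT h ->
    measurable_fun setT (fun x => f (h x)) by move=> ?; exact: measurableT_comp.
have mA : measurable_fun setT (fun p : R * R * R => A p.1.1 p.1.2 p.2).
  have m1 : measurable_fun setT (fun p : R * R * R => p.1.1).
    exact: (measurableT_comp measurable_fst measurable_fst).
  have m2 : measurable_fun setT (fun p : R * R * R => p.1.2).
    exact: (measurableT_comp measurable_snd measurable_fst).
  apply: emeasurable_funM; apply/measurable_EFinP/measurable_funM; apply: mf' => //.
  by apply: measurable_funD => //; exact: measurable_funB.
have A0 x y z : 0 <= A x y z by rewrite mule_ge0// lee_fin mulr_ge0.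
transitivity (\int[mu]_x \int[mu]_y \int[mu]_z A x y z).
  apply: eq_integral => x _; apply: eq_integral => y _.
  rewrite -ge0_integralZl_EFin ?mulr_ge0//.
  - by move=> t _; rewrite lee_fin mulr_ge0.
  - apply/measurable_EFinP/measurable_funM => //.
    by apply: mf'; exact: measurable_funD.
apply: etrans (tonelli3_rev mA A0) _.
apply: eq_integral => x _; apply: eq_integral => y _.
rewrite -ge0_integralZl_EFin ?mulr_ge0//.
- apply: eq_integral => t _; rewrite /A -!EFinM; congr EFin.
  by rewrite opprK (_ : y - t + x = y + x - t)%R; ring.
- by move=> t _; rewrite lee_fin mulr_ge0.
- apply/measurable_EFinP/measurable_funM => //.
  by apply: mf'; exact: measurable_funB.
Qed.

End correlation.

(** * The finite quadratic form on grid cells *)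

Lemma sqr_ge_tangent (R : realFieldType) (a x : R) : 2 * a * x - a ^+ 2 <= x ^+ 2.
Proof. by rewrite -subr_ge0 (_ : _ - _ = (x - a) ^+ 2) ?sqr_ge0//; ring. Qed.

(* The squares are replaced by their tangents at a nearly optimal point [a] (with
   denominator 266), at which the gradient of the form is almost constant on the
   eleven cells 4, ..., 14; what remains is linear in [v]. *)
Lemma window_energy_ge (R : realFieldType) (v : nat -> R) :
    (forall i, 0 <= v i) -> \sum_(i < 4) v i = 0 -> \sum_(i < 15) v i = 2 ->
  249 / 25 <= \sum_(j < 15) (7 * v j ^+ 2 + (\sum_(l < 5) v (j + l)%N) ^+ 2).
Proof.
move=> v0 v4 v15.
(* Beyond cell 14 the default value of [nth] makes [a] vanish, so [b] is also right for the windows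
   that overhang the last cell. *)
pose a : nat -> R := fun i => (nth 0%N
  [:: 0; 0; 0; 0; 73; 53; 42; 38; 39; 43; 39; 38; 42; 53; 73]%N i)%:R / 266.
pose b j := \sum_(l < 5) a (j + l)%N.
pose T j := 7 * (2 * a j * v j - a j ^+ 2) +
  (2 * b j * (\sum_(l < 5) v (j + l)%N) - b j ^+ 2).
apply: (@le_trans _ _ (\sum_(j < 15) T j)); last first.
  by apply: ler_sum => j _; rewrite lerD ?ler_pM2l ?sqr_ge_tangent.
have S5 (F : nat -> R) : \sum_(l < 5) F l = F 0%N + F 1%N + F 2%N + F 3%N + F 4%N.
  by rewrite !big_ord_recr big_ord0 /= add0r.
have S15 (F : nat -> R) : \sum_(l < 15) F l = F 0%N + F 1%N + F 2%N + F 3%N + F 4%N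
  + F 5%N + F 6%N + F 7%N + F 8%N + F 9%N + F 10%N + F 11%N + F 12%N + F 13%N + F 14%N.
  by rewrite !big_ord_recr big_ord0 /= add0r.
rewrite S15; move: v15; rewrite S15 => v15.
move: v4; rewrite !big_ord_recr big_ord0 /= add0r => v4.
have TE j : T j = 7 * (2 * a j * v j - a j ^+ 2) +
    (2 * b j * (v j + v j.+1 + v j.+2 + v j.+3 + v j.+4) - b j ^+ 2).
  by rewrite /T (S5 (fun l => v (j + l)%N)) addn0 addn1 addn2 addn3 addn4.
have bE j : b j = a j + a j.+1 + a j.+2 + a j.+3 + a j.+4.
  by rewrite /b (S5 (fun l => a (j + l)%N)) addn0 addn1 addn2 addn3 addn4.
rewrite !TE !bE /a /=.
have := (v0 0%N, v0 1%N, v0 2%N, v0 3%N, v0 4%N, v0 5%N, v0 6%N, v0 7%N, v0 8%N).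
move=> [[[[[[[[? ?] ?] ?] ?] ?] ?] ?] ?].
have := (v0 9%N, v0 10%N, v0 11%N, v0 12%N, v0 13%N, v0 14%N, v0 15%N, v0 16%N).
move=> [[[[[[[? ?] ?] ?] ?] ?] ?] ?].
(* The windows starting at cells 11 to 14 reach up to cell 18. Cells 15 to 18 have nonnegative
   coefficients in [T], so the sign of [v] there is all that matters. *)
have [? ?] := (v0 17%N, v0 18%N).
lra.
Qed.

(** * Integrals of quadratic polynomials over intervals *)

Section interval_integrals.
Context {R : realType}.
Notation mu := (@lebesgue_measure R).

Lemma integral_deriv_poly (p : {poly R}) (a b : R) : a < b ->
  (\int[mu]_(x in `[a, b]) (p^`().[x])%:E = (p.[b] - p.[a])%:E)%E.
Proof.
move=> ab; have cp (q : {poly R}) : continuous (horner q).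
  by move=> x; apply/differentiable_continuous/derivable1_diffP/derivable_horner.
rewrite (@continuous_FTC2 _ _ (horner p))//.
- exact: continuous_subspaceT.
- split=> [x _| |]; first exact: derivable_horner.
  + by apply: cvg_at_right_filter; exact: cp.
  + by apply: cvg_at_left_filter; exact: cp.
- by move=> x _; rewrite derivE.
Qed.

Lemma integral_quadratic (c0 c1 c2 : R) (G : R -> R) (a b : R) : a < b ->
    (forall x, a <= x <= b -> G x = c0 + c1 * x + c2 * x ^+ 2) ->
  (\int[mu]_(x in `[a, b]) (G x)%:E =
   (c0 * (b - a) + c1 / 2 * (b ^+ 2 - a ^+ 2) + c2 / 3 * (b ^+ 3 - a ^+ 3))%:E)%E.
Proof.
move=> ab GE.
pose p := c0 *: 'X + (c1 / 2) *: 'X^2 + (c2 / 3) *: 'X^3 : {poly R}.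
have pE x : p.[x] = c0 * x + c1 / 2 * x ^+ 2 + c2 / 3 * x ^+ 3.
  by rewrite /p !hornerE.
transitivity (p.[b] - p.[a])%:E; last by rewrite !pE; congr EFin; ring.
rewrite -(integral_deriv_poly p ab); apply: eq_integral => x; rewrite inE/= in_itv/= => /GE ->.
rewrite /p !derivD !derivZ derivX !derivXn /= !(hornerE, hornerMn)/=.
by congr EFin; field.
Qed.

Lemma ge0_integral_itv_split (a b c : R) (F : R -> \bar R) :
    measurable_fun setT F -> (forall x, 0 <= F x)%E -> a <= c <= b ->
  (\int[mu]_(x in `[a, b]) F x =
   \int[mu]_(x in `[a, c]) F x + \int[mu]_(x in `[c, b]) F x)%E.
Proof.
move=> mF F0 /andP[ac cb].
have -> : `[a, b]%classic = `[a, c]%classic `|` `]c, b]%classic.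
  by apply: itv_bndbnd_setU; rewrite bnd_simp.
rewrite ge0_integral_setU//.
- by rewrite integral_itv_obnd_cbnd//; exact: measurable_funS mF.
- exact: measurable_funS mF.
- rewrite disj_set2E; apply/eqP/seteqP; split=> x //=.
  by rewrite !in_itv/= => -[/andP[_ xc] /andP[]]; rewrite ltNge xc.
Qed.

End interval_integrals.

(** * The kernel K and its integrals *)

Section kernel.
Context {R : realType}.
Notation mu := (@lebesgue_measure R).

(** The triangle has height w rather than 1, because this is exactly the autocorrelation of an
    interval of length w. Hence the factors 140 = 7 * 20 and 20 = 5 * 4 in [kern]. *)
Definition tent (w z : R) : R := Num.max 0 (w - `|z|).

Definition kern (z : R) : R := 140 * tent (1 / 20) z + 20 * tent (1 / 4) z.

Lemma tent_ge0 w z : 0 <= tent w z.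
Proof. by rewrite /tent le_max lexx. Qed.

Lemma tentN w z : tent w (- z) = tent w z.
Proof. by rewrite /tent normrN. Qed.

Lemma measurable_tent w : measurable_fun setT (tent w).
Proof.
by apply: measurable_maxr => //; apply: measurable_funB.
Qed.

Lemma kern_ge0 z : 0 <= kern z.
Proof. by apply: addr_ge0; apply: mulr_ge0 => //; exact: tent_ge0. Qed.

Lemma measurable_kern : measurable_fun setT kern.
Proof.
by apply: measurable_funD; apply: measurable_funM => //; exact: measurable_tent.
Qed.

Lemma tent_out (w z : R) : w <= `|z| -> tent w z = 0.
Proof. by move=> wz; rewrite /tent max_l// subr_le0. Qed.

Lemma tent_in (w z : R) : `|z| <= w -> tent w z = w - `|z|.
Proof. by move=> zw; rewrite /tent max_r// subr_ge0. Qed.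

Lemma kern_near (z : R) : `|z| <= 1 / 20 -> kern z = 12 - 160 * `|z|.
Proof. by move=> zw; rewrite /kern !tent_in; lra. Qed.

Lemma kern_mid (z : R) : 1 / 20 <= `|z| <= 1 / 4 -> kern z = 5 - 20 * `|z|.
Proof. by move=> /andP[? ?]; rewrite /kern tent_out// tent_in//; lra. Qed.

Lemma kern_far (z : R) : 1 / 4 <= `|z| -> kern z = 0.
Proof. by move=> ?; rewrite /kern !tent_out; lra. Qed.

(** Both K and (K + 17/5)^2 have this shape. The numerical factors are the integrals of 1, |x| and
    x^2 over the symmetric pieces cut at 1/20, 1/4 and 1/2. *)
Lemma ge0_integral_even_pieces (G : R -> R) (a0 a1 b0 b1 b2 c0 c1 : R) :
    measurable_fun setT G -> (forall x, 0 <= G x) ->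
    (forall x, `|x| <= 1 / 20 -> G x = a0 + a1 * `|x| + c0 * `|x| ^+ 2) ->
    (forall x, 1 / 20 <= `|x| <= 1 / 4 -> G x = b0 + b1 * `|x| + c1 * `|x| ^+ 2) ->
    (forall x, 1 / 4 <= `|x| <= 1 / 2 -> G x = b2) ->
  (\int[mu]_(x in `[(- (1 / 2))%R, (1 / 2)%R]) (G x)%:E =
   (a0 / 10 + a1 / 400 + c0 / 12000 +
    b0 * 2 / 5 + b1 * 3 / 50 + c1 * 31 / 3000 + b2 / 2)%:E)%E.
Proof.
move=> mG G0 Gn Gm Gf.
have mG' : measurable_fun setT (fun x => (G x)%:E) by exact/measurable_EFinP.
have G0' x : (0 <= (G x)%:E)%E by rewrite lee_fin.
rewrite (@ge0_integral_itv_split _ _ _ (- (1/4)))//; last lra.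
rewrite (@ge0_integral_itv_split _ (- (1/4)) _ (- (1/20)))//; last lra.
rewrite (@ge0_integral_itv_split _ (- (1/20)) _ 0)//; last lra.
rewrite (@ge0_integral_itv_split _ 0 _ (1/20))//; last lra.
rewrite (@ge0_integral_itv_split _ (1/20) _ (1/4))//; last lra.
(* The six pieces from left to right; on the negative half the linear coefficient changes sign. *)
rewrite (@integral_quadratic _ b2 0 0); [|lra|]; last first.
  by move=> x ?; rewrite Gf ?ler0_norm; lra.
rewrite (@integral_quadratic _ b0 (- b1) c1); [|lra|]; last first.
  by move=> x ?; rewrite Gm ?ler0_norm; lra.
rewrite (@integral_quadratic _ a0 (- a1) c0); [|lra|]; last first.
  by move=> x ?; rewrite Gn ?ler0_norm; lra.
rewrite (@integral_quadratic _ a0 a1 c0); [|lra|]; last first.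
  by move=> x ?; rewrite Gn ?ger0_norm; lra.
rewrite (@integral_quadratic _ b0 b1 c1); [|lra|]; last first.
  by move=> x ?; rewrite Gm ?ger0_norm; lra.
rewrite (@integral_quadratic _ b2 0 0); [|lra|]; last first.
  by move=> x ?; rewrite Gf ?ger0_norm; lra.
by rewrite -!EFinD; congr EFin; field.
Qed.

Lemma integral_kern : (\int[mu]_x (kern x)%:E = (8 / 5)%:E)%E.
Proof.
have -> : (\int[mu]_x (kern x)%:E =
    \int[mu]_(x in `[(- (1 / 2))%R, (1 / 2)%R]) (kern x)%:E)%E.
  rewrite [RHS]integral_mkcond; apply: eq_integral => x _.
  rewrite patchE; case: ifPn => // /negP; rewrite inE/= in_itv/= -ler_norml => xh.
  by rewrite kern_far//; lra.
rewrite (@ge0_integral_even_pieces _ 12 (- 160) 5 (- 20) 0 0 0).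
- by congr EFin; field.
- exact: measurable_kern.
- exact: kern_ge0.
- by move=> x ?; rewrite kern_near//; ring.
- by move=> x ?; rewrite kern_mid//; ring.
- by move=> x /andP[? _]; rewrite kern_far.
Qed.

Lemma integral_kern_shift_sqr :
  (\int[mu]_(x in `[(- (1 / 2))%R, (1 / 2)%R]) ((kern x + 17 / 5) ^+ 2)%:E =
   (2363 / 75)%:E)%E.
Proof.
(* Here 77/5 = 12 + 17/5 and 42/5 = 5 + 17/5 are the constant terms of K + 17/5 on the two inner
   pieces. *)
rewrite (@ge0_integral_even_pieces _ ((77 / 5) ^+ 2) (- 320 * (77 / 5)) ((42 / 5) ^+ 2)
  (- 40 * (42 / 5)) ((17 / 5) ^+ 2) (160 ^+ 2) (20 ^+ 2)).
- by congr EFin; field.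
- by apply: measurable_funX; apply: measurable_funD => //; exact: measurable_kern.
- by move=> x; exact: sqr_ge0.
- by move=> x ?; rewrite kern_near//; field.
- by move=> x ?; rewrite kern_mid//; field.
- by move=> x /andP[? _]; rewrite kern_far//; field.
Qed.

End kernel.

(** * Upper bounds for the integrals of K against convolution and correlation *)

Section upper.
Context {R : realType}.
Notation mu := (@lebesgue_measure R).
Local Open Scope ereal_scope.
Variable f : R -> R.
Hypotheses (mf : measurable_fun setT f) (f0 : forall x, (0 <= f x)%R).
Hypothesis f_supp : forall x, (1 / 4 < `|x|)%R -> f x = 0%R.
Hypothesis f1 : \int[mu]_x (f x)%:E = 1.
Variable M : R.
Hypothesis M0 : (0 <= M)%R.
Hypothesis fM : \forall z \ae mu, conv_along f -%R z <= M%:E.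

Let corr := conv_along f id.
Let conv := conv_along f -%R.

Let mid : measurable_fun [set: R] (id : R -> R). Proof. by []. Qed.
Let mopp : measurable_fun [set: R] (-%R : R -> R). Proof. exact: oppr_measurable. Qed.
Let mcorr : measurable_fun setT corr. Proof. exact: measurable_conv_along. Qed.
Let mconv : measurable_fun setT conv. Proof. exact: measurable_conv_along. Qed.
Let corr0 z : 0 <= corr z. Proof. exact: conv_along_ge0. Qed.
Let conv0 z : 0 <= conv z. Proof. exact: conv_along_ge0. Qed.
Let mfE : measurable_fun setT (fun x => (f x)%:E). Proof. exact/measurable_EFinP. Qed.

Lemma integral2_ff : \int[mu]_t \int[mu]_y (f t * f y)%:E = 1.
Proof.
rewrite -[RHS]f1; apply: eq_integral => t _.
under eq_integral do rewrite EFinM.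
by rewrite ge0_integralZl_EFin// ?f1 ?mule1// => y _; rewrite lee_fin.
Qed.

(** Only the values of [phi] at y - s(t), with t and y in the support of f, enter the double
    integral. The weight 1 gives the total mass of the convolution; the indicator of [-1/2, 1/2]
    shows that the correlation has mass 1 on this interval. *)
Lemma integral_conv_kernel (s : R -> R) (phi : R -> R) :
    measurable_fun setT s -> measurable_fun setT phi -> (forall x, (0 <= phi x)%R) ->
    (forall t y, (`|t| <= 1 / 4)%R -> (`|y| <= 1 / 4)%R -> phi (y - s t)%R = 1%R) ->
  \int[mu]_z (conv_along f s z * (phi z)%:E) = 1.
Proof.
move=> ms mphi phi0 phi1.
have mphiE : measurable_fun setT (fun x => (phi x)%:E) by exact/measurable_EFinP.
rewrite (integral_conv_along mf f0 ms mphiE); last by move=> x; rewrite lee_fin.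
rewrite -[RHS]integral2_ff.
apply: eq_integral => t _; apply: eq_integral => y _.
have [/f_supp ->|ht] := (ltP (1 / 4) `|t : R|)%R; first by rewrite !mul0r mul0e.
have [/f_supp ->|hy] := (ltP (1 / 4) `|y : R|)%R; first by rewrite !mulr0 mul0e.
by rewrite phi1// mule1.
Qed.

Lemma integral_conv : \int[mu]_z conv z = 1.
Proof.
rewrite -[RHS](@integral_conv_kernel -%R (cst 1%R))//.
by apply: eq_integral => z _; rewrite /= mule1.
Qed.

(** One factor is bounded by M almost everywhere, and the other integrates to 1. *)
Lemma integral_conv_sqr_le : \int[mu]_z (conv z * conv z) <= M%:E.
Proof.
rewrite -[leRHS]mule1 -integral_conv.
rewrite -ge0_integralZl_EFin//.
apply: ae_ge0_le_integral => //.
- by move=> z _; exact: mule_ge0.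
- exact: emeasurable_funM.
- by move=> z _; rewrite mule_ge0.
- exact: emeasurable_funM.
- move: fM; apply: filterS; first exact: (ae_filter_ringOfSetsType mu).
  by move=> z cM _; rewrite lee_wpmul2r.
Qed.

Lemma integral_conv_kern_le :
  \int[mu]_z (conv z * (kern z)%:E) <= (M * (8 / 5))%:E.
Proof.
have mK : measurable_fun [set: R] (fun z : R => (kern z)%:E).
  by apply/measurable_EFinP; exact: measurable_kern.
have K0 (z : R) : 0 <= (kern z)%:E by rewrite lee_fin kern_ge0.
rewrite EFinM -integral_kern -ge0_integralZl_EFin//.
apply: ae_ge0_le_integral => //.
- by move=> z _; exact: mule_ge0.
- exact: emeasurable_funM.
- by move=> z _; rewrite mule_ge0.
- exact: emeasurable_funM.
- move: fM; apply: filterS; first exact: (ae_filter_ringOfSetsType mu).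
  by move=> z cM _; rewrite lee_wpmul2r.
Qed.

(** This is (5 r - k - 17/5)^2 >= 0, rearranged without subtraction because r may be infinite. The
    shift 17/5 gives K + 17/5 the integral 8/5 + 17/5 = 5 over [-1/2, 1/2], the same as 5 rho. *)
Lemma corr_kern_pointwise (r : \bar R) (k : R) : 0 <= r -> (0 <= k)%R ->
  10%:E * (r * k%:E) + 34%:E * r <= 25%:E * (r * r) + ((k + 17 / 5) ^+ 2)%:E.
Proof.
move=> r0 k0; case: r r0 => [r| |]// r0.
  rewrite -!EFinM -!EFinD lee_fin -subr_ge0.
  by rewrite (_ : _ - _ = (5 * r - (k + 17 / 5)) ^+ 2)%R ?sqr_ge0//; field.
by rewrite mulyy [X in _ <= X + _]gt0_muley ?lte_fin// addye// leey.
Qed.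

Lemma integral_corr_kern_le :
  \int[mu]_z (corr z * (kern z)%:E) <= ((25 * M + 2363 / 75 - 34) / 10)%:E.
Proof.
(* The constant 17/5 has a finite integral only over a bounded set; [D] carries all the mass of
   [corr] and contains the support of K. *)
pose D : set R := `[(- (1 / 2))%R, (1 / 2)%R]%classic.
have mD : measurable D by exact: measurable_itv.
have mK : measurable_fun [set: R] (fun z : R => (kern z)%:E).
  by apply/measurable_EFinP; exact: measurable_kern.
have mKK : measurable_fun [set: R] (fun z : R => ((kern z + 17 / 5) ^+ 2)%:E).
  apply/measurable_EFinP/measurable_funX/measurable_funD => //.
  exact: measurable_kern.
have K0 (z : R) : 0 <= (kern z)%:E by rewrite lee_fin kern_ge0.
have H : \int[mu]_(z in D) (10%:E * (corr z * (kern z)%:E) + 34%:E * corr z) <=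
    \int[mu]_(z in D) (25%:E * (corr z * corr z) + ((kern z + 17 / 5) ^+ 2)%:E).
  apply: ge0_le_integral => //.
  - by move=> z _; rewrite adde_ge0// !mule_ge0.
  - apply: measurable_funTS; apply: emeasurable_funD.
      by apply: emeasurable_funM => //; exact: emeasurable_funM.
    exact: emeasurable_funM.
  - apply: measurable_funTS; apply: emeasurable_funD => //.
    by apply: emeasurable_funM => //; exact: emeasurable_funM.
  - by move=> z _; apply: corr_kern_pointwise => //; exact: kern_ge0.
have HL : \int[mu]_(z in D) (10%:E * (corr z * (kern z)%:E) + 34%:E * corr z) =
    10%:E * \int[mu]_(z in D) (corr z * (kern z)%:E) + 34%:E * \int[mu]_(z in D) corr z.
  have m1 : measurable_fun D (fun z => corr z * (kern z)%:E).
    by apply: measurable_funTS; exact: emeasurable_funM.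
  have m2 : measurable_fun D corr by exact: measurable_funTS.
  rewrite ge0_integralD//.
  - by rewrite !ge0_integralZl_EFin// => z _; rewrite mule_ge0.
  - by move=> z _; rewrite !mule_ge0.
  - exact: emeasurable_funM.
  - by move=> z _; rewrite mule_ge0.
  - exact: emeasurable_funM.
have HR : \int[mu]_(z in D) (25%:E * (corr z * corr z) + ((kern z + 17 / 5) ^+ 2)%:E) =
    25%:E * \int[mu]_(z in D) (corr z * corr z) +
    \int[mu]_(z in D) ((kern z + 17 / 5) ^+ 2)%:E.
  have m1 : measurable_fun D (fun z => corr z * corr z).
    by apply: measurable_funTS; exact: emeasurable_funM.
  rewrite ge0_integralD//.
  - by rewrite !ge0_integralZl_EFin// => z _; rewrite mule_ge0.
  - by move=> z _; rewrite !mule_ge0.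
  - exact: emeasurable_funM.
  - by move=> z _; rewrite lee_fin sqr_ge0.
  - exact: measurable_funTS.
rewrite {}HL {}HR in H.
have corrD : \int[mu]_(z in D) corr z = 1.
  rewrite -[RHS](@integral_conv_kernel id \1_D)//.
  - rewrite integral_mkcond; apply: eq_integral => z _.
    by rewrite patchE indicE; case: (z \in D); rewrite ?mule1 ?mule0.
  - move=> t y; rewrite !ler_norml => /andP[t1 t2] /andP[y1 y2].
    by rewrite indicE mem_set// /D/= in_itv/=; apply/andP; split; lra.
have kernD : \int[mu]_(z in D) (corr z * (kern z)%:E) =
    \int[mu]_z (corr z * (kern z)%:E).
  rewrite integral_mkcond; apply: eq_integral => z _.
  rewrite patchE; case: ifPn => // /negP; rewrite inE /D/= in_itv/= -ler_norml => xh.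
  by rewrite kern_far ?mule0//; lra.
have sqrD : \int[mu]_(z in D) (corr z * corr z) <= M%:E.
  apply: le_trans integral_conv_sqr_le.
  rewrite -(integral_corr_sqr mf f0); apply: ge0_subset_integral => //.
  - exact: emeasurable_funM.
  - by move=> z _; exact: mule_ge0.
move: H; rewrite corrD kernD integral_kern_shift_sqr => H.
have : 10%:E * (\int[mu]_z (corr z * (kern z)%:E)) + 34%:E * 1 <=
    25%:E * M%:E + (2363 / 75)%:E.
  by apply: le_trans H _; rewrite leeD2r// lee_pmul2l// lte_fin.
(* The finite right-hand side excludes the value +oo. *)
case: (\int[mu]_z (corr z * (kern z)%:E)) => [r| |]//.
- rewrite mule1 -!EFinM -!EFinD !lee_fin; lra.
- by rewrite gt0_muley ?lte_fin// addye// leye_eq.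
- by rewrite leNye.
Qed.

End upper.

(** * Indicators of half-open intervals and their correlations *)

Section box.
Context {R : realType}.
Notation mu := (@lebesgue_measure R).

(* Half-open, so that the translates of [box s] by multiples of s tile the line. *)
Definition box (w u : R) : R := \1_(`](- w), 0%R]%classic : set R) u.

Lemma box_ge0 w u : 0 <= box w u.
Proof. by rewrite /box indicE. Qed.

Lemma box_le1 w u : box w u <= 1.
Proof. by rewrite /box indicE; case: (_ \in _). Qed.

Lemma box_in w u : - w < u <= 0 -> box w u = 1.
Proof. by move=> wu; rewrite /box indicE mem_set//= in_itv. Qed.

Lemma box_out w u : ~~ (- w < u <= 0) -> box w u = 0.
Proof. by move=> wu; rewrite /box indicE memNset//= in_itv; exact/negP. Qed.

Lemma measurable_box w : measurable_fun setT (box w).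
Proof. exact: measurable_indic. Qed.

Lemma box_split (s u : R) (n : nat) : 0 <= s ->
  box (n%:R * s) u = \sum_(l < n) box s (u + l%:R * s).
Proof.
move=> s0; elim: n => [|n ih].
  rewrite big_ord0 mul0r box_out//; apply/negP => /andP[]; lra.
rewrite big_ord_recr/= -ih -natr1 mulrDl mul1r.
have ns : 0 <= n%:R * s by rewrite mulr_ge0.
(* The additional box is the indicator of [](- (n%:R * s + s)), - (n%:R * s)]], adjacent on the left
   to the interval already covered. *)
have [un|un] := leP u (- (n%:R * s)).
  rewrite [in RHS]box_out ?add0r; last by apply/negP => /andP[]; lra.
  have [us|us] := leP u (- (n%:R * s + s)).
    by rewrite !box_out//; apply/negP => /andP[]; lra.
  by rewrite !box_in//; apply/andP; split; lra.
rewrite [X in _ = _ + X]box_out ?addr0; last by apply/negP => /andP[]; lra.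
have [u0|u0] := leP u 0.
  by rewrite !box_in//; apply/andP; split; lra.
by rewrite !box_out//; apply/negP => /andP[]; lra.
Qed.

Lemma integral_box_mul (w x y : R) : 0 <= w ->
  (\int[mu]_t (box w ((t : R) - x) * box w ((t : R) - y))%:E = (tent w (x - y))%:E)%E.
Proof.
move=> w0; wlog xy : x y / x <= y.
  move=> H; have [/H//|/ltW/H] := leP x y.
  by rewrite -(tentN w (y - x)) opprB => <-; apply: eq_integral => t _; rewrite mulrC.
(* For x <= y the intervals ]x - w, x] and ]y - w, y] meet in ]y - w, x], which is empty as soon as
   y - x >= w. *)
transitivity (\int[mu]_t (\1_(`](y - w)%R, x]%classic : set R) t)%:E)%E.
  apply: eq_integral => t _; congr EFin; rewrite [RHS]indicE.
  have [tab|tab] := boolP ((t : R) \in _).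
    move: tab; rewrite inE/= in_itv/= => /andP[ta tb].
    by rewrite !box_in ?mul1r//; apply/andP; split; lra.
  move: tab; rewrite notin_setE/= in_itv/= => /negP; rewrite negb_and -!leNgt -!ltNge.
  move=> /orP[ta|tb].
    by rewrite [X in _ * X]box_out ?mulr0//; apply/negP => /andP[]; lra.
  by rewrite box_out ?mul0r//; apply/negP => /andP[]; lra.
rewrite integral_indic//= setIT lebesgue_measure_itv/= lte_fin /tent.
rewrite ler0_norm ?subr_le0// opprB.
case: ltP => h; last by rewrite max_l//; lra.
by rewrite max_r -?EFinB; [congr EFin; ring|lra].
Qed.

End box.

(** * Folding an integral over the line onto one grid step *)

Section folding.
Context {R : realType}.
Notation mu := (@lebesgue_measure R).
Local Open Scope ereal_scope.

(** The n translates of []a, a + s]] by multiples of s are disjoint, and F is nonnegative on the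
    part of the line that they miss. *)
Lemma ge0_integral_folding_le (a s : R) (n : nat) (F : R -> \bar R) :
    (0 <= s)%R -> measurable_fun setT F -> (forall x, 0 <= F x) ->
  \int[mu]_(t in `]a, (a + s)%R]) (\sum_(j < n) F ((t : R) + j%:R * s)%R) <=
  \int[mu]_t F t.
Proof.
move=> s0 mF F0.
pose I (j : nat) : set R := `](a + j%:R * s)%R, (a + s + j%:R * s)%R]%classic.
have mI j : measurable (I j) by exact: measurable_itv.
have tI : trivIset [set` iota 0 n] I.
  apply/trivIsetP => /= i j _ _.
  wlog ij : i j / (i < j)%N.
    move=> H; rewrite neq_ltn => /orP[ij|ij]; first by apply: H => //; rewrite ltn_eqF.
    by rewrite setIC; apply: H => //; rewrite ltn_eqF.
  move=> _; apply/seteqP; split=> x //=; rewrite /I/= !in_itv/=.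
  move=> -[/andP[_ xi] /andP[xj _]].
  have : (i.+1%:R * s <= j%:R * s)%R by rewrite ler_wpM2r// ler_nat.
  by rewrite -natr1 mulrDl mul1r; lra.
have shiftI j : \int[mu]_(t in `]a, (a + s)%R]) F ((t : R) + j%:R * s)%R =
    \int[mu]_(t in I j) F t.
  rewrite [RHS]integral_mkcond -(ge0_integral_shift (j%:R * s)); last 2 first.
  - by apply/(measurable_restrictT _ (mI j)); exact: measurable_funTS.
  - by move=> x; rewrite patchE; case: ifP.
  rewrite integral_mkcond; apply: eq_integral => t _; rewrite !patchE.
  congr (if _ then _ else _); apply/idP/idP; rewrite !inE/= /I/= !in_itv/=;
    by move=> /andP[? ?]; apply/andP; split; lra.
rewrite ge0_integral_sum//; last first.
- move=> j; apply: measurable_funTS; apply: measurableT_comp => //.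
  exact: measurable_funD.
rewrite (eq_bigr (fun j : 'I_n => \int[mu]_(t in I j) F t)); last first.
  by move=> j _; exact: shiftI.
rewrite -(big_mkord xpredT (fun j => \int[mu]_(t in I j) F t)).
rewrite /index_iota subn0 -ge0_integral_bigsetU//.
- by apply: ge0_subset_integral => //; apply: bigsetU_measurable => j _; exact: mI.
- exact: iota_uniq.
- exact: measurable_funTS.
Qed.

End folding.

(** * Masses of sliding windows and their square integrals *)

Section windows.
Context {R : realType}.
Notation mu := (@lebesgue_measure R).
Local Open Scope ereal_scope.
Variable f : R -> R.
Hypotheses (mf : measurable_fun setT f) (f0 : forall x, (0 <= f x)%R).

Definition sym_box (w x t : R) : R := (box w (t - x) + box w (t + x))%R.

(** Since [sym_box w x t] counts which of x and -x lie in [t, t + w[, this is the mass that f(x) +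
    f(-x) gives to [t, t + w[. *)
Definition window (w t : R) : \bar R := \int[mu]_x (f x * sym_box w x t)%:E.

Lemma sym_box_ge0 w x t : (0 <= sym_box w x t)%R.
Proof. by rewrite addr_ge0// box_ge0. Qed.

Lemma measurable_sym_box w : measurable_fun setT (fun p : R * R => sym_box w p.1 p.2).
Proof.
apply: measurable_funD; apply: (measurableT_comp (measurable_box w)).
  exact: measurable_funB.
exact: measurable_funD.
Qed.

(** The product expands into four correlations of boxes, which coincide in pairs because [tent] is
    even; hence the factor 2. *)
Lemma integral_sym_box_mul (w x y : R) : (0 <= w)%R ->
  \int[mu]_t (sym_box w x t * sym_box w y t)%:E =
  (2 * (tent w (y - x) + tent w (y + x)))%:E.
Proof.
move=> w0.
have mb (a : R) : measurable_fun setT (fun t : R => box w (t + a)).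
  by apply: (measurableT_comp (measurable_box w)); exact: measurable_funD.
have mbb (a b : R) : measurable_fun setT (fun t : R => (box w (t + a) * box w (t + b))%:E).
  by apply/measurable_EFinP/measurable_funM.
have bb0 (a b t : R) : 0 <= (box w (t + a) * box w (t + b))%:E.
  by rewrite lee_fin mulr_ge0// box_ge0.
have E (a b : R) :
    \int[mu]_t (box w ((t : R) + a) * box w ((t : R) + b))%:E = (tent w (b - a))%:E.
  by have := integral_box_mul (- a) (- b) w0; rewrite !opprK addrC.
transitivity (\int[mu]_t (
   ((box w ((t : R) + - x) * box w ((t : R) + - y))%:E +
    (box w ((t : R) + - x) * box w ((t : R) + y))%:E) +
   ((box w ((t : R) + x) * box w ((t : R) + - y))%:E +
    (box w ((t : R) + x) * box w ((t : R) + y))%:E))).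
  apply: eq_integral => t _; rewrite -!EFinD; congr EFin; rewrite /sym_box; ring.
have mD (a b c d : R) : measurable_fun setT (fun t : R =>
    (box w (t + a) * box w (t + b))%:E + (box w (t + c) * box w (t + d))%:E).
  exact: emeasurable_funD.
rewrite ge0_integralD//; [|by move=> t _; rewrite adde_ge0|exact: mD
  |by move=> t _; rewrite adde_ge0|exact: mD].
rewrite !ge0_integralD//; try exact: mbb.
transitivity (((tent w (- y - - x))%:E + (tent w (y - - x))%:E) +
    ((tent w (- y - x))%:E + (tent w (y - x))%:E)).
  by congr ((_ + _) + (_ + _)); exact: E.
rewrite -!EFinD; congr EFin.
rewrite (_ : - y - - x = - (y - x))%R; last by ring.
rewrite (_ : - y - x = - (y + x))%R; last by ring.
by rewrite !tentN opprK; ring.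
Qed.

Lemma measurable_window w : measurable_fun setT (window w).
Proof.
apply: (@measurable_integral_snd R _ R (fun t x : R => (f x * sym_box w x t)%:E)).
- apply/measurable_EFinP/measurable_funM; first exact: measurableT_comp.
  have ms : measurable_fun setT (fun p : R * R => (p.2, p.1)).
    exact: measurable_fun_pair.
  exact: (measurableT_comp (measurable_sym_box w) ms).
- by move=> t x; rewrite lee_fin mulr_ge0// sym_box_ge0.
Qed.

Lemma window_ge0 w t : 0 <= window w t.
Proof. by apply: integral_ge0 => x _; rewrite lee_fin mulr_ge0// sym_box_ge0. Qed.

(** The square is written as a double integral over x and y, and Tonelli allows t to be integrated
    first. *)
Lemma integral_window_sqr (w : R) : (0 <= w)%R ->
  \int[mu]_t (window w t * window w t) =
  \int[mu]_x \int[mu]_y ((f x * f y)%:E *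
    (2 * (tent w ((y : R) - x) + tent w ((y : R) + x)))%:E).
Proof.
move=> w0.
pose A (t x y : R) := (f x * sym_box w x t)%:E * (f y * sym_box w y t)%:E.
have fs0 x t : 0 <= (f x * sym_box w x t)%:E.
  by rewrite lee_fin mulr_ge0// sym_box_ge0.
have A0 t x y : 0 <= A t x y by rewrite mule_ge0.
have mfs d (T : measurableType d) (h1 h2 : T -> R) : measurable_fun setT h1 ->
    measurable_fun setT h2 ->
    measurable_fun setT (fun p => (f (h1 p) * sym_box w (h1 p) (h2 p))%:E).
  move=> m1 m2; apply/measurable_EFinP/measurable_funM; first exact: measurableT_comp.
  have mh : measurable_fun setT (fun p => (h1 p, h2 p)) by exact: measurable_fun_pair.
  exact: (measurableT_comp (measurable_sym_box w) mh).
have m11 : measurable_fun setT (fun p : R * R * R => p.1.1).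
  exact: (measurableT_comp measurable_fst measurable_fst).
have m12 : measurable_fun setT (fun p : R * R * R => p.1.2).
  exact: (measurableT_comp measurable_snd measurable_fst).
have mA : measurable_fun setT (fun p : R * R * R => A p.1.1 p.1.2 p.2).
  by apply: emeasurable_funM; exact: mfs.
transitivity (\int[mu]_t \int[mu]_x \int[mu]_y A t x y).
  apply: eq_integral => t _.
  rewrite -ge0_integralZr//; last 2 first.
  - exact: (mfs _ _ id (cst t)).
  - exact: window_ge0.
  apply: eq_integral => x _.
  rewrite -ge0_integralZl//; exact: (mfs _ _ id (cst t)).
apply: etrans (tonelli3_rot mA A0) _.
apply: eq_integral => x _; apply: eq_integral => y _.
rewrite -integral_sym_box_mul// -ge0_integralZl_EFin//.
- by apply: eq_integral => t _; rewrite /A -!EFinM; congr EFin; ring.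
- by move=> t _; rewrite lee_fin mulr_ge0// sym_box_ge0.
- have ms (a : R) : measurable_fun setT (fun t : R => sym_box w a t).
    exact: (measurableT_comp (measurable_sym_box w) (measurable_pair1 a)).
  apply/measurable_EFinP/measurable_funM; exact: ms.
- by rewrite mulr_ge0.
Qed.

End windows.

(** * The lower bound for the kernel energy *)

Section energy.
Context {R : realType}.
Notation mu := (@lebesgue_measure R).
Local Open Scope ereal_scope.
Variable f : R -> R.
Hypotheses (mf : measurable_fun setT f) (f0 : forall x, (0 <= f x)%R).

Definition energy (phi : R -> R -> R) : \bar R :=
  \int[mu]_x \int[mu]_y ((f x * f y)%:E * (phi x y)%:E).

Section energy_linear.
Variables phi psi : R -> R -> R.
Hypotheses (mphi : measurable_fun setT (fun p : R * R => phi p.1 p.2))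
  (mpsi : measurable_fun setT (fun p : R * R => psi p.1 p.2))
  (phi0 : forall x y, (0 <= phi x y)%R) (psi0 : forall x y, (0 <= psi x y)%R).

Let mff (h : R -> R -> R) : measurable_fun setT (fun p : R * R => h p.1 p.2) ->
  measurable_fun setT (fun p : R * R => (f p.1 * f p.2)%:E * (h p.1 p.2)%:E).
Proof.
move=> mh; apply: emeasurable_funM; last exact/measurable_EFinP.
by apply/measurable_EFinP/measurable_funM; exact: measurableT_comp.
Qed.

Let mffx (h : R -> R -> R) x : measurable_fun setT (fun p : R * R => h p.1 p.2) ->
  measurable_fun setT (fun y : R => (f x * f y)%:E * (h x y)%:E).
Proof. by move=> mh; exact: (measurableT_comp (mff mh) (measurable_pair1 x)). Qed.

Let ff0 (h : R -> R -> R) : (forall x y, (0 <= h x y)%R) ->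
  forall x y, 0 <= (f x * f y)%:E * (h x y)%:E.
Proof. by move=> h0 x y; rewrite mule_ge0// lee_fin// mulr_ge0. Qed.

Lemma energyD : energy (fun x y => phi x y + psi x y)%R = energy phi + energy psi.
Proof.
rewrite /energy -ge0_integralD//.
- apply: eq_integral => x _; rewrite -ge0_integralD//.
  + by apply: eq_integral => y _; rewrite EFinD ge0_muleDr// lee_fin.
  + by move=> y _; exact: ff0.
  + exact: mffx.
  + by move=> y _; exact: ff0.
  + exact: mffx.
- by move=> x _; apply: integral_ge0 => y _; exact: ff0.
- exact: (measurable_integral_snd (mff mphi) (ff0 phi0)).
- by move=> x _; apply: integral_ge0 => y _; exact: ff0.
- exact: (measurable_integral_snd (mff mpsi) (ff0 psi0)).
Qed.

Lemma energyZ (k : R) : (0 <= k)%R ->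
  energy (fun x y => k * phi x y)%R = k%:E * energy phi.
Proof.
move=> k0; rewrite /energy -ge0_integralZl_EFin//.
- apply: eq_integral => x _; rewrite -ge0_integralZl_EFin//.
  + by apply: eq_integral => y _; rewrite EFinM muleCA.
  + by move=> y _; exact: ff0.
  + exact: mffx.
- by move=> x _; apply: integral_ge0 => y _; exact: ff0.
- exact: (measurable_integral_snd (mff mphi) (ff0 phi0)).
Qed.

End energy_linear.

Lemma window_split (s t : R) (n : nat) : (0 <= s)%R ->
  window f (n%:R * s) t = \sum_(l < n) window f s (t + l%:R * s)%R.
Proof.
move=> s0; rewrite /window -ge0_integral_sum//.
- apply: eq_integral => x _; rewrite sumEFin; congr EFin.
  rewrite -mulr_sumr; congr (_ * _)%R.
  rewrite /sym_box big_split/= !box_split//.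
  by congr (_ + _)%R; apply: eq_bigr => l _; congr box; ring.
- move=> l; apply/measurable_EFinP/measurable_funM => //.
  exact: (measurableT_comp (measurable_sym_box s) (measurable_pair2 _)).
- by move=> l x _; rewrite lee_fin mulr_ge0// sym_box_ge0.
Qed.

Hypothesis f_supp : forall x, (1 / 4 < `|x|)%R -> f x = 0%R.
Hypothesis f1 : \int[mu]_x (f x)%:E = 1.

(** Serves with c = 0 for a window that misses the support of f, and with c = 2 for one that
    contains it. *)
Lemma window_cst (w t c : R) : (0 <= c)%R ->
    (forall x, (`|x| <= 1 / 4)%R -> sym_box w x t = c) ->
  window f w t = c%:E.
Proof.
move=> c0 hc; rewrite -[RHS]mule1 -f1 -ge0_integralZl_EFin//; last 2 first.
- by move=> x _; rewrite lee_fin.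
- exact/measurable_EFinP.
apply: eq_integral => x _; rewrite -EFinM; congr EFin.
have [/f_supp ->|xs] := (ltP (1 / 4) `|x : R|)%R; first by rewrite mul0r mulr0.
by rewrite hc// mulrC.
Qed.

Lemma window_fin_num (w t : R) : window f w t \is a fin_num.
Proof.
rewrite ge0_fin_numE ?window_ge0//.
apply: (@le_lt_trans _ _ (2%:E * 1)); last by rewrite mule1 ltry.
rewrite -f1 -ge0_integralZl_EFin//; last 2 first.
- by move=> x _; rewrite lee_fin.
- exact/measurable_EFinP.
apply: ge0_le_integral => //.
- by move=> x _; rewrite lee_fin mulr_ge0// sym_box_ge0.
- apply/measurable_EFinP/measurable_funM => //.
  exact: (measurableT_comp (measurable_sym_box w) (measurable_pair2 _)).
- by apply: emeasurable_funM => //; exact/measurable_EFinP.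
- move=> x _; rewrite -EFinM lee_fin mulrC ler_wpM2r//.
  by rewrite /sym_box; have := box_le1 w (t - x); have := box_le1 w (t + x); lra.
Qed.

Definition window_energy (t : R) : \bar R :=
  7%:E * (window f (1 / 20) t * window f (1 / 20) t) +
  window f (1 / 4) t * window f (1 / 4) t.

(** For t in this range the finite form applies: the first four cells end at t + 1/5 <= -1/4, and
    fifteen cells reach t + 3/4 > 1/4. The support therefore lies in cells 4 to 14. *)
Lemma window_energy_pointwise (t : R) : (- (1 / 2) < t <= - (9 / 20))%R ->
  (249 / 25)%:E <= \sum_(j < 15) window_energy (t + j%:R * (1 / 20))%R.
Proof.
move=> /andP[t1 t2].
pose v (j : nat) := fine (window f (1 / 20) (t + j%:R * (1 / 20))%R).
have vE j : window f (1 / 20) (t + j%:R * (1 / 20))%R = (v j)%:E.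
  by rewrite fineK// window_fin_num.
have v0 j : (0 <= v j)%R by rewrite fine_ge0// window_ge0.
have s0 : (0 <= 1 / 20 :> R)%R by lra.
have sumv n : window f (n%:R * (1 / 20)) t = (\sum_(l < n) v l)%:E.
  by rewrite window_split// -sumEFin; apply: eq_bigr.
have v4 : (\sum_(l < 4) v l = 0)%R.
  apply: EFin_inj; rewrite -sumv; apply: window_cst => // x.
  rewrite ler_norml => /andP[x1 x2].
  by rewrite /sym_box !box_out ?addr0//; apply/negP => /andP[]; lra.
have v15 : (\sum_(l < 15) v l = 2)%R.
  apply: EFin_inj; rewrite -sumv; apply: window_cst => // x.
  rewrite ler_norml => /andP[x1 x2].
  by rewrite /sym_box !box_in //; apply/andP; split; lra.
(* A window of length 1/4 consists of five consecutive cells. *)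
have w5 j : window f (1 / 4) (t + j%:R * (1 / 20))%R = (\sum_(l < 5) v (j + l)%N)%:E.
  rewrite (_ : 1 / 4 = 5%:R * (1 / 20))%R; last by field.
  rewrite window_split// -sumEFin; apply: eq_bigr => l _.
  by rewrite -vE natrD; congr window; ring.
under eq_bigr do rewrite /window_energy vE w5 -!EFinM -EFinD -!expr2.
rewrite sumEFin lee_fin; exact: window_energy_ge.
Qed.

(** The two integrals add up to ten times the integral of [window_energy], which is folded onto
    offsets t in a single grid step, where the pointwise bound holds. *)
Lemma energy_kern_ge :
  (249 / 50)%:E <= \int[mu]_z (conv_along f id z * (kern z)%:E) +
                   \int[mu]_z (conv_along f -%R z * (kern z)%:E).
Proof.
have mK : measurable_fun [set: R] (fun z : R => (kern z)%:E).
  by apply/measurable_EFinP; exact: measurable_kern.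
have K0 (z : R) : 0 <= (kern z)%:E by rewrite lee_fin kern_ge0.
have mI : measurable_fun [set: R] (id : R -> R) by [].
have mN : measurable_fun [set: R] (-%R : R -> R) by exact: oppr_measurable.
have mB : measurable_fun setT (fun p : R * R => p.2 - p.1)%R by exact: measurable_funB.
have mD : measurable_fun setT (fun p : R * R => p.2 + p.1)%R by exact: measurable_funD.
have mm (h : R -> R) : measurable_fun setT h ->
    measurable_fun setT (fun p : R * R => h (p.2 - p.1) + h (p.2 + p.1))%R.
  move=> mh; apply: measurable_funD.
    exact: (measurableT_comp mh mB).
  exact: (measurableT_comp mh mD).
have -> : \int[mu]_z (conv_along f id z * (kern z)%:E) =
    energy (fun x y => kern (y - x)).
  exact: integral_conv_along.
have -> : \int[mu]_z (conv_along f -%R z * (kern z)%:E) =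
    energy (fun x y => kern (y + x)).
  apply: etrans (integral_conv_along mf f0 mN mK K0) _.
  by apply: eq_integral => x _; apply: eq_integral => y _; rewrite opprK.
rewrite -energyD; first last.
- by move=> *; exact: kern_ge0.
- by move=> *; exact: kern_ge0.
- exact: (measurableT_comp measurable_kern mD).
- exact: (measurableT_comp measurable_kern mB).
pose T w x y : R := (2 * (tent w (y - x) + tent w (y + x)))%R.
have T0 w x y : (0 <= T w x y)%R by rewrite mulr_ge0// addr_ge0// tent_ge0.
have mT w : measurable_fun setT (fun p : R * R => T w p.1 p.2).
  apply: measurable_funM => //; apply: mm; exact: measurable_tent.
pose F := window_energy.
have m7 : measurable_fun setT (fun t => 7%:E * (window f (1 / 20) t * window f (1 / 20) t)).
  apply: emeasurable_funM => //; apply: emeasurable_funM; exact: measurable_window.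
have m1 : measurable_fun setT (fun t => window f (1 / 4) t * window f (1 / 4) t).
  apply: emeasurable_funM; exact: measurable_window.
have ww0 w t : 0 <= window f w t * window f w t by rewrite mule_ge0// window_ge0.
have F0 t : 0 <= F t by rewrite adde_ge0// mule_ge0.
have mF : measurable_fun setT F by exact: emeasurable_funD.
have FE : \int[mu]_t F t = energy (fun x y => 7 * T (1 / 20) x y + T (1 / 4) x y)%R.
  rewrite energyD//; first last.
  - by move=> x y; rewrite mulr_ge0.
  - by apply: measurable_funM => //; exact: mT.
  rewrite energyZ// ge0_integralD//; first last.
  - by move=> t _; rewrite mule_ge0.
  congr (_ + _); last by apply: integral_window_sqr => //; lra.
  have S0 (t : R) : setT t -> 0 <= window f (1 / 20) t * window f (1 / 20) t by [].
  have mS : measurable_fun setT (fun t => window f (1 / 20) t * window f (1 / 20) t).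
    by apply: emeasurable_funM; exact: measurable_window.
  apply: etrans (ge0_integralZl_EFin mu measurableT S0 mS _) _ => //.
  by congr (_ * _); apply: integral_window_sqr => //; lra.
(* The factor 2 in [T] gives 140 = 10 * 7 * 2 and 20 = 10 * 2. *)
have FK : energy (fun x y => kern (y - x) + kern (y + x))%R = 10%:E * \int[mu]_t F t.
  apply: etrans _ (congr1 (mule 10%:E) (esym FE)).
  have T20 x y : (0 <= 7 * T (1 / 20) x y + T (1 / 4) x y)%R.
    by rewrite addr_ge0// mulr_ge0.
  have mT2 : measurable_fun setT
      (fun p : R * R => 7 * T (1 / 20) p.1 p.2 + T (1 / 4) p.1 p.2)%R.
    by apply: measurable_funD => //; apply: measurable_funM => //; exact: mT.
  have k0 : (0 <= 10 :> R)%R by [].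
  apply: etrans _ (energyZ mT2 T20 k0).
  apply: eq_integral => x _; apply: eq_integral => y _; congr (_ * _%:E).
  by rewrite /kern /T; ring.
rewrite {}FK (_ : (249 / 50)%:E = 10%:E * (249 / 25 * (1 / 20))%:E); last first.
  by rewrite -EFinM; congr EFin; field.
rewrite lee_pmul2l ?lte_fin//.
(* The offsets run over ]-1/2, -9/20], an interval of length 1/20, which explains the last factor in
   249/50 = 10 * 249/25 * 1/20. *)
apply: le_trans (ge0_integral_folding_le (- (1 / 2)) 15 (s := 1 / 20) _ mF F0); last lra.
have muI : mu `](- (1 / 2))%R, (- (1 / 2) + 1 / 20)%R]%classic = (1 / 20)%:E.
  rewrite lebesgue_measure_itv/= lte_fin ifT; last lra.
  by rewrite -EFinB; congr EFin; ring.
rewrite EFinM -muI -integral_cst//.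
apply: ge0_le_integral => //.
- by move=> t _ /=; rewrite lee_fin.
- apply: emeasurable_sum => j; apply: measurable_funTS; apply: measurableT_comp => //.
  exact: measurable_funD.
- move=> t /=; rewrite in_itv/= => /andP[t1 t2].
  by apply: window_energy_pointwise; apply/andP; split; lra.
Qed.

End energy.

(** * From the completed Lebesgue measure to the Borel one *)

Section completed.
Context {R : realType}.
Notation mu := (@lebesgue_measure R).
Notation cmu := (@completed_lebesgue_measure R).
Notation hlength := (@wlength R idfun).
Notation LR := (caratheodory_type (hlength^*)%mu).

Lemma borel_completed_measurable (A : set R) :
  measurable A -> hlength^*%mu.-cara.-measurable A.
Proof. exact: sub_caratheodory. Qed.

(** In the completion, A is the union of a Borel set and a subset of a Borel null set. *)
Lemma completed_measurable_borel (A : set R) : hlength^*%mu.-cara.-measurable A ->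
  exists X B : set R, [/\ measurable X, measurable B, mu B = 0%E, X `<=` A & A `<=` X `|` B].
Proof.
rewrite -completed_caratheodory_measurable g_sigma_completed_algebra_genE.
move=> [X mX [N [B [mB B0 NB]] <-]]; exists X, B; split => //.
by move=> x [|/NB]; [left|right].
Qed.

(** A null cover of A lies between a Borel set X and its union with a Borel null set; X is null by
    monotonicity of the outer measure. *)
Lemma completed_negligible (A : set R) : cmu.-negligible A -> mu.-negligible A.
Proof.
move=> [C [/completed_measurable_borel [X [B [mX mB B0 XC CXB]]] C0 AC]].
have AXB : A `<=` X `|` B := subset_trans AC CXB.
apply: (@negligibleS _ (measurableTypeR R) R mu _ _ AXB).
apply: (@negligibleU _ (measurableTypeR R) R mu).
  apply/negligibleP => //; apply/eqP; rewrite -measure_le0 -[leRHS]C0.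
  exact: (@le_outer_measure _ _ (hlength^*)%mu).
exact/negligibleP.
Qed.

Lemma borel_completed_measurable_fun (F : R -> \bar R) :
  measurable_fun setT F -> measurable_fun (setT : set LR) (F : LR -> \bar R).
Proof.
by move=> mF _ B mB; apply: borel_completed_measurable; exact: mF.
Qed.

(** The identity map from the completed space to the Borel space pushes [cmu] forward to [mu]. *)
Lemma ge0_integral_completed (F : R -> \bar R) : measurable_fun setT F ->
  (forall x, 0 <= F x)%E -> (\int[cmu]_x F x = \int[mu]_x F x)%E.
Proof.
move=> mF F0; pose h : LR -> measurableTypeR R := fun x => x.
have mh : measurable_fun setT h.
  by move=> _ B mB; rewrite setTI; exact: borel_completed_measurable.
have P := @ge0_integral_pushforward _ _ LR (measurableTypeR R) R h mh cmu setT F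
  measurableT mF (fun y _ => F0 y).
apply: etrans (esym P) _; unshelve refine (eq_measure_integral _ _) => //.
Qed.

(** Each of the countably many sets {f > q}, q rational, has a Borel core [X q] up to a Borel null
    set [B q]. With N the union of the [B q], membership in [X q] means q < f outside N. *)
Lemma lebesgue_borel_version (f : R -> R) : measurable_fun (setT : set LR) (f : LR -> R) ->
  exists N : set R, [/\ measurable N, mu N = 0%E &
    measurable_fun setT (fun x : R => if x \in N then 0 else f x)].
Proof.
move=> mf.
have mfq (q : rat) : hlength^*%mu.-cara.-measurable (f @^-1` `]ratr q, +oo[%classic).
  rewrite -[X in measurable X]setTI; apply: (mf measurableT).
  exact: measurable_itv.
have /choice[X /choice[B XB]] q := completed_measurable_borel (mfq q).
have mX q : measurable (X q) by have [] := XB q.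
have mB q : measurable (B q) by have [] := XB q.
pose N := \bigcup_q B q.
have mN : measurable N by exact: bigcupT_measurable_rat.
exists N; split => //.
  apply/(negligibleP (mu : {measure set (measurableTypeR R) -> \bar R})) => //.
  (* The rationals are enumerated by naturals, to use countable subadditivity over [nat]. *)
  pose B' (n : nat) := if unpickle n is Some q then B q else set0.
  apply: (@negligibleS _ (measurableTypeR R) R mu (\bigcup_n B' n)).
    move=> x [q _ Bx]; exists (pickle q); first exact: I.
    rewrite /B' pickleK; exact: Bx.
  apply: negligible_bigcup => n; rewrite /B'; case: unpickle => [q|].
    by exists (B q); split=> //; have [] := XB q.
  exact: negligible_set0.
have XN q x : x \notin N -> X q x <-> ratr q < f x.
  move=> /negP xN; have [_ _ _ XA AXB] := XB q.
  split=> [/XA|fx]; first by rewrite /= in_itv/= andbT.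
  have /AXB[//|Bx] : (f @^-1` `]ratr q, +oo[%classic) x by rewrite /= in_itv/= fx.
  by case: xN; rewrite inE; exists q.
apply: (measurability _ (RGenOInfty.measurableE R)) => // _ [_ [y ->] <-].
rewrite setTI.
(* The modified function is 0 on N, so N belongs to the superlevel set exactly when y < 0. *)
have -> : (fun x : R => if x \in N then 0 else f x) @^-1` `]y, +oo[%classic =
    (\bigcup_(q in [set q | y < ratr q]) (X q `\` N)) `|`
    (if y < 0 then N else set0).
  apply/seteqP; split=> x /=; rewrite in_itv/= andbT.
    case: ifPn => xN.
      by move=> y0; right; rewrite y0; exact: set_mem.
    move=> /rat_in_itvoo[q]; rewrite in_itv/= => /andP[yq qf].
    left; exists q => //; split; [exact/XN|].
    by move=> Nx; move: xN; rewrite notin_setE; exact.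
  move=> [[q /= yq [Xx Nx]]|].
    have xN : x \notin N by rewrite notin_setE.
    by rewrite (negbTE xN); apply: lt_trans yq _; exact/XN.
  by case: ifP => // y0 Nx; rewrite mem_set.
apply: measurableU; last by case: ifP.
rewrite bigcup_mkcond; apply: bigcupT_measurable_rat => q.
by case: ifP => // _; exact: measurableD.
Qed.

Lemma integrable_completed_measurable (f : R -> R) :
  cmu.-integrable setT (EFin \o f) -> measurable_fun (setT : set LR) (f : LR -> R).
Proof. by move=> /measurable_int/measurable_EFinP. Qed.

End completed.

(* 3187 / 2500 = 1.2748 *)
Theorem theorem3p2 (R : realType) (f : R -> R)
    (f_supp : forall x : R, x \notin `[- (1 / 4), 1 / 4] -> f x = 0)
    (f_ge0 : forall x : R, 0 <= f x)
    (f_int : (@completed_lebesgue_measure R).-integrable setT (EFin \o f))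
    (f_int1 : (\int[@completed_lebesgue_measure R]_x (f x)%:E = 1)%E) :
  ((3187 / 2500)%:E <= ess_sup (@completed_lebesgue_measure R) (autoconv f))%E.
Proof.
have mf := integrable_completed_measurable f_int.
have [N [mN N0 mg]] := lebesgue_borel_version mf.
(* From here on f is replaced by its Borel version [g], which keeps the sign, the support and the
   integral. *)
set g := (fun x : R => _) in mg.
have g_ge0 x : 0 <= g x by rewrite /g; case: ifP.
have g_supp x : 1 / 4 < `|x| -> g x = 0.
  move=> x4; rewrite /g; case: ifP => // _; apply: f_supp.
  by rewrite in_itv/= -ler_norml -ltNge.
have mgE : measurable_fun setT (fun x => (g x)%:E) by exact/measurable_EFinP.
have cN : (@completed_lebesgue_measure R) N = 0%E by [].
have g1 : (\int[@lebesgue_measure R]_x (g x)%:E = 1)%E.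
  rewrite -ge0_integral_completed//.
  apply: etrans _ f_int1; apply: ge0_ae_eq_integral; first by [].
  - exact: borel_completed_measurable_fun.
  - exact: (measurable_int _ f_int).
  - by move=> x _; rewrite lee_fin.
  - by move=> x _; rewrite lee_fin.
  - exists N; split; [exact: borel_completed_measurable|exact: cN|].
    move=> x /= /not_implyP[_ xN]; apply: contrapT => Nx; apply: xN.
    by rewrite /g memNset.
(* This holds at every x: the two integrands in t differ only on the union of N and x - N, a null
   set by reflection invariance. *)
have autoconvE : autoconv f = conv_along g -%R.
  apply/funext => x.
  pose N' := (fun t : R => x - t) @^-1` N.
  have mN' : measurable N'.
    by rewrite -[X in measurable X]setTI; apply: measurable_funB.
  have N'0 : @lebesgue_measure R N' = 0%E by rewrite lebesgue_measure_reflect.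
  have mgg : measurable_fun setT (fun t => (g t * g (x - t))%:E).
    apply/measurable_EFinP/measurable_funM => //.
    by apply: measurableT_comp => //; exact: measurable_funB.
  have fg : ae_eq (@completed_lebesgue_measure R) setT
      (fun t => (g t * g (x - (t : R)))%:E) (fun t => (f t * f (x - (t : R)))%:E).
    exists (N `|` N'); split.
    - by apply: borel_completed_measurable; exact: measurableU.
    - apply: (measure_negligible (mu := @lebesgue_measure R)).
        exact: measurableU.
      by apply: negligibleU; apply/negligibleP.
    - move=> t /= /not_implyP[_ fgt]; apply: contrapT => /not_orP[tN tN'].
      by apply: fgt; rewrite /g !memNset.
  rewrite /autoconv /conv_along -ge0_integral_completed//; last first.
    by move=> t; rewrite lee_fin mulr_ge0.
  apply/esym/ge0_ae_eq_integral; first by [].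
  - exact: borel_completed_measurable_fun.
  - apply: ae_measurable_fun fg _; first exact: completed_lebesgue_measure_is_complete.
    exact: borel_completed_measurable_fun.
  - by move=> t _; rewrite lee_fin mulr_ge0.
  - by move=> t _; rewrite lee_fin mulr_ge0.
  - exact: fg.
(* A smaller essential supremum would bound the autoconvolution by M = 3187/2500 almost
   everywhere. *)
rewrite leNgt; apply/negP => /ltW/ess_supP fM.
have gM : (\forall z \ae @lebesgue_measure R, conv_along g -%R z <= (3187 / 2500)%:E)%E.
  by apply: completed_negligible; rewrite -autoconvE.
have mg' : measurable_fun setT g by [].
have M0 : 0 <= 3187 / 2500 :> R by lra.
have := energy_kern_ge mg' g_ge0 g_supp g1.
move=> /le_trans/(_ (leeD (integral_corr_kern_le mg' g_ge0 g_supp g1 M0 gM)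
  (integral_conv_kern_le mg' g_ge0 M0 gM))).
(* The upper bounds add up to 41/10 M - 187/750, which is less than 249/50 for this M. *)
rewrite -EFinD lee_fin; lra.
Qed.
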